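(* Let $G$ be the isometry group of $\mathbb{H}^n$, with associated symmetric space $\mathbb{X}=\mathbb{H}^n$, equipped with its metric of sectional curvature $-1$. Let $M$ be a smooth connected manifold. An immersion $u:M\to\mathbb{H}^n$ is $\tau$-nearly geodesic for the only element $\tau\in\mathbb{S}\mathfrak{a}^+$ if and only if $u$ has principal curvature in $(-1,1)$.
   Context: Since $\mathbb{H}^n$ has rank one, the set $\mathbb{S}\mathfrak{a}^+$ of unit vectors of the model Weyl chamber has a single element $\tau$, $\tau$ equals its image $\iota(\tau)$ under the opposition involution, and the associated $G$-orbit $\mathcal{F}_\tau=\mathcal{F}_{\iota(\tau)}$ in the visual boundary is all of $\partial\mathbb{H}^n$. For $a\in\partial\mathbb{H}^n$ and a base point $o$, the Busemann function is $b_{a,o}(x)=\lim_{t\to+\infty}(d(x,\gamma(t))-d(o,\gamma(t)))$ for a unit speed geodesic ray $\gamma$ ending at $a$. An immersion $u:M\to\mathbb{H}^n$ is $\tau$-nearly geodesic if for all $a\in\partial\mathbb{H}^n$ and all nonzero $\mathrm{v}\in TM$ with $\mathrm{d}(b_{a,o}\circ u)(\mathrm{v})=0$, the Hessian of $b_{a,o}\circ u$, for the induced metric on $M$, is positive in the direction $\mathrm{v}$. An immersion $u:M\to\mathbb{H}^n$ (of any codimension) has principal curvature in $(-1,1)$ if $\lVert\mathrm{d}u(\mathrm{v})\rVert^2>\lVert\mathrm{I\!I}_u(\mathrm{v},\mathrm{v})\rVert$ for all nonzero $\mathrm{v}\in TM$, where $\mathrm{I\!I}_u$ is the second fundamental form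 with values in the normal bundle. *)

(* Defs.v *)
From HB Require Import structures.
From mathcomp Require Import all_boot all_order all_algebra.
From mathcomp Require Import all_classical all_reals all_analysis.

Set Implicit Arguments.
Unset Strict Implicit.
Unset Printing Implicit Defensive.

Import Order.TTheory GRing.Theory Num.Theory.
Import numFieldNormedType.Exports.

Local Open Scope classical_set_scope.
Local Open Scope ring_scope.

Section SmoothManifold.
Variables (R : realType) (m : nat).

(* Meant for [U] open, so that all derivatives at points of [U] depend only on
   the values of [f] in [U]. *)
Fixpoint Ck_on (W : normedModType R) (k : nat) (U : set 'rV[R]_m)
    (f : 'rV[R]_m -> W) : Prop :=
  if k is k'.+1 then
    (forall x, U x -> differentiable f x) /\
    (forall v : 'rV[R]_m, Ck_on k' U (fun x => 'D_v f x))
  else forall x, U x -> {for x, continuous f}.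

Definition smooth_on (W : normedModType R) (U : set 'rV[R]_m)
    (f : 'rV[R]_m -> W) : Prop := forall k, Ck_on k U f.

(* [chart_map] and [chart_inv] are total functions; their values outside
   [chart_dom] and [chart_cod] are irrelevant. *)
Record chart (M : topologicalType) := Chart {
  chart_dom : set M;
  chart_cod : set 'rV[R]_m;
  chart_map : M -> 'rV[R]_m;
  chart_inv : 'rV[R]_m -> M;
  chart_dom_open : open chart_dom;
  chart_cod_open : open chart_cod;
  chart_map_cod : forall p, chart_dom p -> chart_cod (chart_map p);
  chart_inv_dom : forall x, chart_cod x -> chart_dom (chart_inv x);
  chart_mapK : forall p, chart_dom p -> chart_inv (chart_map p) = p;
  chart_invK : forall x, chart_cod x -> chart_map (chart_inv x) = x;
  chart_map_continuous :
    forall p, chart_dom p -> {for p, continuous chart_map};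
  chart_inv_continuous :
    forall x, chart_cod x -> {for x, continuous chart_inv} }.

Definition smooth_atlas (M : topologicalType) (A : set (chart M)) : Prop :=
  (forall p : M, exists2 c, A c & chart_dom c p) /\
  (forall c c', A c -> A c' ->
     smooth_on [set x | chart_cod c x /\ chart_dom c' (chart_inv c x)]
               (chart_map c' \o chart_inv c)).

Definition smooth_manifold (M : topologicalType) (A : set (chart M)) : Prop :=
  [/\ hausdorff_space M, @second_countable M & smooth_atlas A].

End SmoothManifold.

Section RiemannianCoordinates.
Variables (R : realType) (m : nat).

Definition partial (W : normedModType R) (i : 'I_m) (f : 'rV[R]_m -> W)
    (x : 'rV[R]_m) : W := 'D_(delta_mx 0 i : 'rV[R]_m) f x.

(* $\Gamma^k_{ij}$ of the metric $g$, in coordinates *)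
Definition christoffel (g : 'rV[R]_m -> 'M[R]_m) (k i j : 'I_m)
    (x : 'rV[R]_m) : R :=
  2^-1 * \sum_(l < m) invmx (g x) k l *
    (partial i (fun y => g y j l) x + partial j (fun y => g y i l) x
     - partial l (fun y => g y i j) x).

Definition hessian (g : 'rV[R]_m -> 'M[R]_m) (f : 'rV[R]_m -> R)
    (x v w : 'rV[R]_m) : R :=
  \sum_(i < m) \sum_(j < m) v 0 i * w 0 j *
    (partial i (partial j f) x
     - \sum_(k < m) christoffel g k i j x * partial k f x).

End RiemannianCoordinates.

(* The hyperboloid model: $\mathbb{H}^n$ is the upper sheet of
   $\langle x, x\rangle = -1$ in $\mathbb{R}^{1,n}$, with the Riemannian metric
   induced by the Lorentz form, of sectional curvature $-1$. *)
Section HyperbolicSpace.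
Variables (R : realType) (n : nat).
Implicit Types (x y o w : 'rV[R]_n.+1) (c : R -> 'rV[R]_n.+1).

Definition lorentz x y : R :=
  - (x 0 ord0 * y 0 ord0) + \sum_(i < n) x 0 (lift ord0 i) * y 0 (lift ord0 i).

(* The norm of vectors tangent to $\mathbb{H}^n$, on which [lorentz] is
   positive definite. *)
Definition lorentz_norm w : R := Num.sqrt (lorentz w w).

Definition hyperbolic_space : set 'rV[R]_n.+1 :=
  [set x | lorentz x x = -1 /\ 0 < x 0 ord0].

Definition arcosh (z : R) : R := ln (z + Num.sqrt (z ^+ 2 - 1)).

Definition hdist x y : R := arcosh (- lorentz x y).

(* Only the values of a ray on $[0, +\infty)$ matter. *)
Definition geodesic_ray c : Prop :=
  (forall t, 0 <= t -> hyperbolic_space (c t)) /\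
  (forall s t, 0 <= s -> 0 <= t -> hdist (c s) (c t) = `|s - t|).

Definition asymptotic c c' : Prop :=
  exists C : R, forall t, 0 <= t -> hdist (c t) (c' t) <= C.

Definition ray_class c : set (R -> 'rV[R]_n.+1) :=
  [set c' | geodesic_ray c' /\ asymptotic c c'].

Definition visual_boundary : set (set (R -> 'rV[R]_n.+1)) :=
  [set a | exists2 c, geodesic_ray c & a = ray_class c].

Definition ray_to (a : set (R -> 'rV[R]_n.+1)) : R -> 'rV[R]_n.+1 :=
  xget (fun=> 0) a.

(* $b_{a,o}(x)$; it does not depend on the ray chosen in the class [a]. *)
Definition busemann (a : set (R -> 'rV[R]_n.+1)) o x : R :=
  lim ((hdist x (ray_to a t) - hdist o (ray_to a t)) @[t --> +oo]).

(* Orthogonal projection of $\mathbb{R}^{1,n}$ onto $T_x\mathbb{H}^n$; applied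
   to ambient second derivatives it gives the Levi-Civita connection of
   $\mathbb{H}^n$. *)
Definition tangent_proj x w : 'rV[R]_n.+1 := w + lorentz w x *: x.

End HyperbolicSpace.

(* Local formulas for a parametrization [f] of an immersed submanifold. *)
Section LocalImmersion.
Variables (R : realType) (m n : nat).
Variable f : 'rV[R]_m -> 'rV[R]_n.+1.
Implicit Types (x v w : 'rV[R]_m).

Definition induced_metric x : 'M[R]_m :=
  \matrix_(i, j) lorentz (partial i f x) (partial j f x).

(* The component, orthogonal to the image of $\mathrm{d}f_x$, of a vector [z]
   tangent to $\mathbb{H}^n$ at [f x]. *)
Definition normal_part x (z : 'rV[R]_n.+1) : 'rV[R]_n.+1 :=
  z - \sum_(k < m) \sum_(l < m)
        (invmx (induced_metric x) k l * lorentz z (partial l f x))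
          *: partial k f x.

Definition second_fundamental_form x v w : 'rV[R]_n.+1 :=
  \sum_(i < m) \sum_(j < m) (v 0 i * w 0 j) *:
    normal_part x (tangent_proj (f x) (partial i (partial j f) x)).

End LocalImmersion.

(* A tangent vector of [M] at [p] is given by its coordinates [v : 'rV_m] in a
   chart around [p]; the conditions below are required in every chart of the
   atlas, and do not depend on that chart. *)
Section Immersions.
Variables (R : realType) (m n : nat) (M : topologicalType).
Variable A : set (chart R m M).
Variable u : M -> 'rV[R]_n.+1.

Definition immersion : Prop :=
  [/\ forall p, hyperbolic_space (u p),
      forall c, A c -> smooth_on (chart_cod c) (u \o chart_inv c)
    & forall c p (v : 'rV[R]_m), A c -> chart_dom c p -> v != 0 ->
        'D_v (u \o chart_inv c) (chart_map c p) != 0].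

Definition nearly_geodesic (o : 'rV[R]_n.+1) : Prop :=
  forall (a : set (R -> 'rV[R]_n.+1)) c p (v : 'rV[R]_m),
    visual_boundary a -> A c -> chart_dom c p -> v != 0 ->
    'D_v (busemann a o \o u \o chart_inv c) (chart_map c p) = 0 ->
    0 < hessian (induced_metric (u \o chart_inv c))
          (busemann a o \o u \o chart_inv c) (chart_map c p) v v.

Definition principal_curvature_lt1 : Prop :=
  forall c p (v : 'rV[R]_m), A c -> chart_dom c p -> v != 0 ->
    lorentz_norm (second_fundamental_form (u \o chart_inv c)
                    (chart_map c p) v v)
    < lorentz_norm ('D_v (u \o chart_inv c) (chart_map c p)) ^+ 2.

End Immersions.

(* Main.v *)
Require Import Defs.
From mathcomp Require Import all_boot all_order all_algebra.
From mathcomp Require Import all_classical all_reals all_analysis.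
From mathcomp Require Import ring lra.

Set Implicit Arguments.
Unset Strict Implicit.
Unset Printing Implicit Defensive.

Import Order.TTheory GRing.Theory Num.Theory.
Import numFieldNormedType.Exports.

Local Open Scope classical_set_scope.
Local Open Scope ring_scope.

(** Write $\langle\cdot,\cdot\rangle$ for the Lorentz form. A unit speed
geodesic ray of the hyperboloid is $t \mapsto (e^t\xi + e^{-t}\eta)/2$ with
$\xi, \eta$ null, future and $\langle\xi,\eta\rangle = -2$
([geodesic_ray_null]), its endpoint determines the line of $\xi$
([asymptotic_null_rays]), and letting $t \to \infty$ in the distance formula
gives the Busemann function ([busemann_null_ray], [busemann_ray_class])
$$b_{a,o}(x) = \ln(-\langle x,\xi\rangle) - \ln(-\langle o,\xi\rangle).$$

Let $f$ be the immersion read in a chart, and put $V = \mathrm{d}f(v)$. The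
Christoffel symbols of the induced metric are
$\sum_l g^{kl}\langle\partial_i\partial_j f, \partial_l f\rangle$ (this
uses the symmetry of second derivatives, [derive_symmetric]), so that
$\partial_i\partial_j f - \sum_k\Gamma^k_{ij}\partial_k f$ is
$\mathrm{I\!I}_{ij} + g_{ij} f$: the last term is the second fundamental form
of the hyperboloid in the ambient space. As $\langle\cdot,\xi\rangle$ is
linear, this yields ([hessian_log])
$$\mathrm{Hess}(b_{a,o}\circ f)(v,v) =
  \frac{\langle \mathrm{I\!I}(v,v),\xi\rangle}{\langle f,\xi\rangle}
  + \langle V,V\rangle
  - \Big(\frac{\langle V,\xi\rangle}{\langle f,\xi\rangle}\Big)^2.$$
The last square vanishes exactly when $v$ is critical for $b_{a,o}\circ f$.
Rescaling $\xi$ to $f + e$, with $e$ a unit vector tangent to the hyperboloid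
at $f$, the Hessian in a critical direction is
$\lVert V\rVert^2 - \langle\mathrm{I\!I}(v,v), e\rangle$.

Cauchy-Schwarz makes it positive when
$\lVert\mathrm{I\!I}(v,v)\rVert < \lVert V\rVert^2$. Conversely
$\mathrm{I\!I}(v,v)$ is normal, so $e = \mathrm{I\!I}(v,v) /
\lVert\mathrm{I\!I}(v,v)\rVert$ is a direction for which $v$ is critical,
and positivity there is the strict inequality. Both implications hold tangent
vector by tangent vector ([busemann_hessian_gt0_iff]). *)

(** * The Lorentz form and the hyperboloid *)

Section LorentzForm.
Variables (R : realType) (n : nat).
Implicit Types (x y z w p : 'rV[R]_n.+1) (k : R).

Lemma lorentzC x y : lorentz x y = lorentz y x.
Proof.
by rewrite /lorentz mulrC; congr (_ + _); apply: eq_bigr => i _; rewrite mulrC.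
Qed.

Lemma lorentzDl x y z : lorentz (x + y) z = lorentz x z + lorentz y z.
Proof.
rewrite /lorentz !mxE mulrDl opprD addrACA -big_split/=; congr (_ + _).
by apply: eq_bigr => i _; rewrite !mxE mulrDl.
Qed.

Lemma lorentzZl k x y : lorentz (k *: x) y = k * lorentz x y.
Proof.
rewrite /lorentz !mxE mulrDr mulrN -mulrA mulr_sumr; congr (_ + _).
by apply: eq_bigr => i _; rewrite !mxE mulrA.
Qed.

Lemma lorentzNl x y : lorentz (- x) y = - lorentz x y.
Proof. by rewrite -scaleN1r lorentzZl mulN1r. Qed.

Lemma lorentzBl x y z : lorentz (x - y) z = lorentz x z - lorentz y z.
Proof. by rewrite lorentzDl lorentzNl. Qed.

Lemma lorentzDr x y z : lorentz x (y + z) = lorentz x y + lorentz x z.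
Proof. by rewrite lorentzC lorentzDl !(lorentzC x). Qed.

Lemma lorentzZr k x y : lorentz x (k *: y) = k * lorentz x y.
Proof. by rewrite lorentzC lorentzZl lorentzC. Qed.

Lemma lorentzNr x y : lorentz x (- y) = - lorentz x y.
Proof. by rewrite lorentzC lorentzNl lorentzC. Qed.

Lemma lorentzBr x y z : lorentz x (y - z) = lorentz x y - lorentz x z.
Proof. by rewrite lorentzDr lorentzNr. Qed.

Lemma lorentz0l x : lorentz 0 x = 0.
Proof. by rewrite -(scale0r (0 : 'rV[R]_n.+1)) lorentzZl mul0r. Qed.

Lemma lorentz_suml (I : Type) (r : seq I) (P : pred I)
    (F : I -> 'rV[R]_n.+1) x :
  lorentz (\sum_(i <- r | P i) F i) x = \sum_(i <- r | P i) lorentz (F i) x.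
Proof.
by apply: (big_morph (fun z => lorentz z x)) => [y z|];
  [exact: lorentzDl | exact: lorentz0l].
Qed.

Definition lorentzE := (lorentzDl, lorentzDr, lorentzNl, lorentzNr,
  lorentzZl, lorentzZr).

Lemma lorentz_ge0_of_head0 w : w 0 ord0 = 0 -> 0 <= lorentz w w.
Proof.
move=> w0; rewrite /lorentz w0 mulr0 oppr0 add0r.
by apply: sumr_ge0 => i _; rewrite -expr2 sqr_ge0.
Qed.

Lemma lorentz_eq0_of_head0 w : w 0 ord0 = 0 -> lorentz w w = 0 -> w = 0.
Proof.
move=> w0; rewrite /lorentz w0 mulr0 oppr0 add0r => /eqP.
rewrite psumr_eq0; last by move=> i _; rewrite -expr2 sqr_ge0.
move=> /allP s0; apply/rowP => i; rewrite mxE.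
have [j ->|->] := unliftP ord0 i; last exact: w0.
by have := s0 j (mem_index_enum _); rewrite /= mulf_eq0 orbb => /eqP.
Qed.

(** This combination of [x] and [y] has vanishing time coordinate, hence
nonnegative square; expanding that square gives every comparison below between
causal vectors. *)
Let mix x y := y 0 ord0 *: x - x 0 ord0 *: y.

Let mix_head0 x y : mix x y 0 ord0 = 0.
Proof. by rewrite !mxE mulrC subrr. Qed.

Let mix_sqr x y : lorentz (mix x y) (mix x y) =
  y 0 ord0 ^+ 2 * lorentz x x + x 0 ord0 ^+ 2 * lorentz y y
  - 2 * (x 0 ord0 * y 0 ord0) * lorentz x y.
Proof. by rewrite /mix !lorentzE (lorentzC y x); ring. Qed.

Lemma lorentz_mix x y :
  2 * (x 0 ord0 * y 0 ord0) * lorentz x y <=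
  y 0 ord0 ^+ 2 * lorentz x x + x 0 ord0 ^+ 2 * lorentz y y.
Proof.
by rewrite -subr_ge0 -mix_sqr; apply: lorentz_ge0_of_head0; exact: mix_head0.
Qed.

(** Together with [hyperbolic_orthogonal_eq0]: the form is positive definite on
the tangent space at [x]. *)
Lemma hyperbolic_orthogonal_ge0 x w :
  hyperbolic_space x -> lorentz w x = 0 -> 0 <= lorentz w w.
Proof.
move=> [xx x0] wx; have := lorentz_mix x w.
rewrite xx lorentzC wx mulr0 mulrN1 addrC subr_ge0 => h.
by rewrite -(pmulr_rge0 _ (exprn_gt0 2 x0)) (le_trans _ h)// sqr_ge0.
Qed.

Lemma hyperbolic_orthogonal_eq0 x w :
  hyperbolic_space x -> lorentz w x = 0 -> lorentz w w = 0 -> w = 0.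
Proof.
move=> [xx x0] wx ww; apply: lorentz_eq0_of_head0 => //.
have := lorentz_mix x w; rewrite xx lorentzC wx ww !mulr0 addr0 mulrN1.
by rewrite oppr_ge0 => h; apply/eqP; rewrite -sqrf_eq0 eq_le h sqr_ge0.
Qed.

Lemma hyperbolic_causal_lt0 x y : hyperbolic_space x ->
  lorentz y y <= 0 -> 0 < y 0 ord0 -> lorentz x y < 0.
Proof.
move=> [xx x0] yy y0; have := lorentz_mix x y; rewrite xx => h.
have h1 : x 0 ord0 ^+ 2 * lorentz y y <= 0 by rewrite mulr_ge0_le0// sqr_ge0.
have h2 : 0 < y 0 ord0 ^+ 2 by rewrite exprn_gt0.
have h3 : 0 < 2 * (x 0 ord0 * y 0 ord0) by rewrite !mulr_gt0.
rewrite -(pmulr_rlt0 _ h3); lra.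
Qed.

(** A causal vector with zero time coordinate vanishes, and one in the past cone
pairs positively with [x] by the previous lemma applied to its opposite. *)
Lemma causal_head_gt0 x y : hyperbolic_space x ->
  lorentz y y <= 0 -> lorentz x y < 0 -> 0 < y 0 ord0.
Proof.
move=> hx yy xy; rewrite ltNge; apply/negP; rewrite le_eqVlt => /orP[/eqP y0|y0].
  have y00 : y = 0.
    apply: lorentz_eq0_of_head0 => //; apply/eqP; rewrite eq_le yy.
    by rewrite lorentz_ge0_of_head0.
  by move: xy; rewrite y00 lorentzC lorentz0l ltxx.
have := @hyperbolic_causal_lt0 x (- y) hx.
rewrite !lorentzE opprK mxE oppr_gt0 oppr_lt0 => /(_ yy y0) h.
by move: (lt_trans h xy); rewrite ltxx.
Qed.

Lemma null_lorentz_le0 x y : lorentz x x = 0 -> lorentz y y = 0 ->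
  0 < x 0 ord0 -> 0 < y 0 ord0 -> lorentz x y <= 0.
Proof.
move=> xx yy x0 y0; have := lorentz_mix x y.
by rewrite xx yy !mulr0 addr0 pmulr_rle0// !mulr_gt0.
Qed.

(** Reversed Cauchy-Schwarz: the component of [y] orthogonal to [x] has square
$\langle x,y\rangle^2 - 1$, and the sign of $\langle x,y\rangle$ is known. *)
Lemma hyperbolic_lorentz_leN1 x y :
  hyperbolic_space x -> hyperbolic_space y -> lorentz x y <= -1.
Proof.
move=> hx hy; have [xx x0] := hx; have [yy y0] := hy.
have xy : lorentz x y < 0.
  by apply: hyperbolic_causal_lt0 => //; rewrite yy; lra.
have := @hyperbolic_orthogonal_ge0 x (y + lorentz x y *: x) hx.
rewrite !lorentzE xx yy (lorentzC y x) => h; have := h ltac:(ring).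
move=> h'; nra.
Qed.

End LorentzForm.

(** * Geodesic rays and Busemann functions *)

Section HyperbolicFunctions.
Variable R : realType.
Implicit Types t z : R.

Definition cosh t : R := (expR t + expR (- t)) / 2.
Definition sinh t : R := (expR t - expR (- t)) / 2.

Lemma expR_mulN t : expR t * expR (- t) = 1.
Proof. by rewrite expRxMexpNx_1. Qed.

Lemma cosh_sqr t : cosh t ^+ 2 = 1 + sinh t ^+ 2.
Proof. by rewrite -[X in _ = X + _](expR_mulN t) /cosh /sinh; field. Qed.

Lemma cosh_norm t : cosh `|t| = cosh t.
Proof. by rewrite /cosh; case: (ger0P t) => _ //; rewrite opprK addrC. Qed.

Lemma coshB s t : cosh (s - t) = cosh s * cosh t - sinh s * sinh t.
Proof. by rewrite /cosh /sinh opprB !expRD; field. Qed.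

Lemma arcosh_cosh t : arcosh (cosh t) = `|t|.
Proof.
rewrite -cosh_norm /arcosh cosh_sqr [1 + _]addrC addrK sqrtr_sqr.
rewrite [`|sinh _|]ger0_norm.
  by rewrite (_ : _ + _ = expR `|t|) ?expRK// /cosh /sinh; field.
rewrite /sinh divr_ge0 ?subr_ge0 ?ler_expR//.
by rewrite (le_trans _ (normr_ge0 t))// oppr_le0.
Qed.

Lemma cosh_arcosh z : 1 <= z -> cosh (arcosh z) = z.
Proof.
move=> z1; rewrite /cosh expRN /arcosh.
have s0 : 0 <= Num.sqrt (z ^+ 2 - 1) by rewrite sqrtr_ge0.
rewrite lnK; last by rewrite posrE; lra.
have : Num.sqrt (z ^+ 2 - 1) ^+ 2 = z ^+ 2 - 1.
  by rewrite sqr_sqrtr// subr_ge0 expr2; nra.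
move: s0; set s := Num.sqrt _ => s0 ss.
have -> : (z + s)^-1 = z - s.
  apply: (mulfI (x := z + s)); first by lra.
  by rewrite mulfV; [nra|lra].
by field.
Qed.

Lemma le_expR_arcosh z : 1 <= z -> z <= expR (arcosh z).
Proof.
have := sqrtr_ge0 (z ^+ 2 - 1) => s0 z1; rewrite /arcosh lnK; last first.
  by rewrite posrE; lra.
by lra.
Qed.

Lemma sinh1_neq0 : sinh 1 != 0.
Proof.
have : expR (- 1) < expR 1 :> R by rewrite ltr_expR; lra.
by rewrite /sinh; lra.
Qed.

(** Everything on the right is expressed through $e^{-t}$ and $z e^{-t}$, which
converge when $z$ grows like $e^t$: this is the form in which the limit defining
a Busemann function is computed. *)
Lemma arcosh_sub z t : 1 <= z -> arcosh z - t =
  ln (z * expR (- t) + Num.sqrt ((z * expR (- t)) ^+ 2 - expR (- t) ^+ 2)).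
Proof.
move=> z1; have e0 := expR_gt0 (- t).
have -> : (z * expR (- t)) ^+ 2 - expR (- t) ^+ 2 =
    (z ^+ 2 - 1) * expR (- t) ^+ 2.
  by ring.
have zz : 0 <= z ^+ 2 - 1 by rewrite subr_ge0; nra.
rewrite sqrtrM// sqrtr_sqr gtr0_norm// -mulrDl lnM ?expRK ?posrE//.
by have := sqrtr_ge0 (z ^+ 2 - 1); lra.
Qed.

End HyperbolicFunctions.

Section Boundary.
Variables (R : realType) (n : nat).
Implicit Types (x y o p v xi eta : 'rV[R]_n.+1) (c : R -> 'rV[R]_n.+1) (t : R).

Definition null_ray xi eta t : 'rV[R]_n.+1 :=
  2^-1 *: (expR t *: xi + expR (- t) *: eta).

(** A pair of null vectors spanning a Lorentzian plane: $(\xi+\eta)/2$ is a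
point of the hyperboloid and $(\xi-\eta)/2$ a unit vector tangent there. *)
Definition null_frame xi eta : Prop :=
  [/\ lorentz xi xi = 0, lorentz eta eta = 0, lorentz xi eta = -2,
      0 < xi 0 ord0 & 0 < eta 0 ord0].

Lemma null_frame_of_unit p v : hyperbolic_space p -> lorentz v p = 0 ->
  lorentz v v = 1 -> null_frame (p + v) (p - v).
Proof.
move=> hp vp vv; have [pp p0] := hp; have pv := vp; rewrite lorentzC in pv.
split; rewrite ?lorentzE ?pp ?vp ?pv ?vv; try lra.
- by apply: (causal_head_gt0 hp); rewrite !lorentzE ?pp ?vp ?pv ?vv; lra.
- by apply: (causal_head_gt0 hp); rewrite !lorentzE ?pp ?vp ?pv ?vv; lra.
Qed.

Lemma null_ray_unit p v t :
  null_ray (p + v) (p - v) t = cosh t *: p + sinh t *: v.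
Proof.
by apply/rowP => i; rewrite /null_ray /cosh /sinh !mxE; field.
Qed.

Lemma null_ray_hyperbolic xi eta t :
  null_frame xi eta -> hyperbolic_space (null_ray xi eta t).
Proof.
move=> [xx ee xe x0 e0]; split; last first.
  by rewrite !mxE mulr_gt0 ?invr_gt0// addr_gt0// mulr_gt0// expR_gt0.
rewrite /null_ray !lorentzE xx ee (lorentzC eta) xe.
have := expR_mulN t; set a := expR t; set b := expR _ => ab.
by transitivity (- (a * b)); [field|rewrite ab].
Qed.

Lemma null_ray_geodesic xi eta :
  null_frame xi eta -> geodesic_ray (null_ray xi eta).
Proof.
move=> h; split=> [t _|s t _ _]; first exact: null_ray_hyperbolic.
have [xx ee xe x0 e0] := h.
rewrite -arcosh_cosh /hdist; congr arcosh.
by rewrite /null_ray /cosh !lorentzE xx ee (lorentzC eta) xe opprB !expRD; field.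
Qed.

Lemma hdist_cosh x y : hyperbolic_space x -> hyperbolic_space y ->
  lorentz x y = - cosh (hdist x y).
Proof.
move=> hx hy; rewrite /hdist cosh_arcosh ?opprK//.
by have := hyperbolic_lorentz_leN1 hx hy; lra.
Qed.

(** The Gram matrix of $c(0), c(1), c(t)$ is prescribed by the distances, and it
is the Gram matrix of points of one hyperbolic line. Hence the difference
between $c(t)$ and the point at time $t$ of the line through $c(0)$ and $c(1)$
is orthogonal to $c(0)$ and of square zero, so it vanishes. *)
Lemma geodesic_ray_null c : geodesic_ray c ->
  exists xi eta, null_frame xi eta /\
    forall t, 0 <= t -> c t = null_ray xi eta t.
Proof.
move=> [ch cd].
have cc s t : 0 <= s -> 0 <= t -> lorentz (c s) (c t) = - cosh (s - t).
  move=> s0 t0; rewrite hdist_cosh ?cd ?cosh_norm//; exact: ch.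
have s1 := sinh1_neq0 R.
(* [v] is the velocity at time 0 of the line through [c 0] and [c 1]. *)
pose p := c 0; pose v := (sinh 1)^-1 *: (c 1 - cosh 1 *: p).
have hp : hyperbolic_space p by exact: ch.
have pp : lorentz p p = -1 by case: hp.
have c11 : lorentz (c 1) (c 1) = -1 by case: (ch _ ler01).
have cp t : 0 <= t -> lorentz (c t) p = - cosh t.
  by move=> t0; rewrite cc// subr0.
have vp : lorentz v p = 0.
  by rewrite /v !lorentzE cp// pp; ring.
have vv : lorentz v v = 1.
  rewrite /v !lorentzE (lorentzC p (c 1)) pp c11 cp//.
  apply: (mulfI (x := sinh 1 ^+ 2)); first by rewrite sqrf_eq0.
  by rewrite mulr1 -[RHS](addKr 1) -cosh_sqr; field.
have cv t : 0 <= t -> lorentz (c t) v = sinh t.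
  move=> t0; rewrite /v !lorentzE cp// cc// coshB.
  field; exact: s1.
clearbody v; clearbody p.
exists (p + v), (p - v); split; first exact: null_frame_of_unit.
move=> t t0; rewrite null_ray_unit; apply/eqP; rewrite -subr_eq0; apply/eqP.
have ct : lorentz (c t) (c t) = -1 by case: (ch _ t0).
apply: (hyperbolic_orthogonal_eq0 hp); rewrite !lorentzE.
  by rewrite cp// vp pp; ring.
rewrite (lorentzC p (c t)) (lorentzC v (c t)) (lorentzC p v) cp// cv// ct pp vp vv.
by have := cosh_sqr t; lra.
Qed.

Lemma null_lorentz_lt0 x xi eta : null_frame xi eta -> hyperbolic_space x ->
  lorentz x xi < 0.
Proof. by move=> [xx _ _ x0 _] hx; apply: hyperbolic_causal_lt0; rewrite ?xx. Qed.

(** With $s = e^{-t}$ the difference is a function of [s] that is continuous at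
[0], of value $\ln(-\langle x,\xi\rangle)$ there. *)
Lemma cvg_hdist_null_ray x xi eta : null_frame xi eta -> hyperbolic_space x ->
  (hdist x (null_ray xi eta t) - t) @[t --> +oo] --> ln (- lorentz x xi).
Proof.
move=> h hx; set a := - lorentz x xi; set b := - lorentz x eta.
have a0 : 0 < a by rewrite oppr_gt0; exact: null_lorentz_lt0 h hx.
pose w (s : R) := (a + s ^+ 2 * b) / 2.
pose phi (s : R) := ln (w s + Num.sqrt (w s ^+ 2 - s ^+ 2)).
have -> : (fun t => hdist x (null_ray xi eta t) - t) = (fun t => phi (expR (- t))).
  apply/funext => t; rewrite /hdist arcosh_sub; last first.
    by have := hyperbolic_lorentz_leN1 hx (null_ray_hyperbolic t h); lra.
  rewrite /phi.
  suff -> : - lorentz x (null_ray xi eta t) * expR (- t) = w (expR (- t)).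
    by [].
  rewrite /w /null_ray !lorentzE -/a -/b.
  have := expR_mulN t; set e := expR t; set e' := expR _ => ee.
  rewrite (_ : - _ * _ = (e * e' * a + e' ^+ 2 * b) / 2).
    by rewrite ee mul1r.
  by rewrite /a /b; field.
have w0 : w 0 = a / 2 by rewrite /w expr0n mul0r addr0.
have <- : phi 0 = ln a.
  rewrite /phi w0 expr0n subr0 sqrtr_sqr ger0_norm; last by lra.
  by congr ln; field.
apply: (cvg_comp (fun t : R => expR (- t)) phi); first exact: cvgr_expR.
have cw : {for 0, continuous w}.
  rewrite /continuous_at /w; apply: cvgMl; apply: cvgD; first exact: cvg_cst.
  apply: cvgM; last exact: cvg_cst.
  exact: exprn_continuous.
have cs : {for 0, continuous (fun s : R => w s + Num.sqrt (w s ^+ 2 - s ^+ 2))}.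
  rewrite /continuous_at; apply: cvgD; first exact: cw.
  apply: (continuous_comp (f := fun s : R => w s ^+ 2 - s ^+ 2)
    (g := Num.sqrt)); last exact: sqrt_continuous.
  rewrite /continuous_at; apply: cvgB; last exact: exprn_continuous.
  apply: (continuous_comp (f := w) (g := fun s : R => s ^+ 2)) => //.
  exact: exprn_continuous.
apply: (continuous_comp cs (g := @ln R)); apply: continuous_ln.
rewrite w0 expr0n subr0; have := sqrtr_ge0 ((a / 2) ^+ 2); lra.
Qed.

Lemma busemann_null_ray (a : set (R -> 'rV[R]_n.+1)) o x xi eta :
  null_frame xi eta -> hyperbolic_space o -> hyperbolic_space x ->
  (forall t, 0 <= t -> ray_to a t = null_ray xi eta t) ->
  busemann a o x = ln (- lorentz x xi) - ln (- lorentz o xi).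
Proof.
move=> h ho hx ha; rewrite /busemann; apply: cvg_lim; first exact: Rhausdorff.
apply: cvg_trans (cvgB (cvg_hdist_null_ray h hx) (cvg_hdist_null_ray h ho)).
apply: near_eq_cvg; near=> t.
rewrite ha; last by near: t; apply: nbhs_pinfty_ge; rewrite num_real.
by rewrite !fctE; ring.
Unshelve. all: by end_near. Qed.

Lemma ray_to_mem (a : set (R -> 'rV[R]_n.+1)) : visual_boundary a -> a (ray_to a).
Proof.
move=> [c hc ->]; apply: (xgetPex (fun=> 0)); exists c; split => //.
exists 0 => t t0; case: hc => _ ->//; by rewrite subrr normr0.
Qed.

Lemma visual_boundary_ray (a : set (R -> 'rV[R]_n.+1)) :
  visual_boundary a -> geodesic_ray (ray_to a).
Proof. by move=> ha; have := ray_to_mem ha; case: ha => c hc -> []. Qed.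

(** The difference of the two sides is orthogonal to the point [p] and has
square zero. *)
Lemma null_proportional x y p : hyperbolic_space p ->
  lorentz p x = -1 -> lorentz x x = 0 -> lorentz y y = 0 ->
  lorentz x y = 0 -> y = - lorentz p y *: x.
Proof.
move=> hp px xx yy xy; apply/eqP; rewrite -subr_eq0; apply/eqP.
apply: (hyperbolic_orthogonal_eq0 hp); rewrite !lorentzE.
  by rewrite (lorentzC x p) px (lorentzC y p); ring.
by rewrite (lorentzC y x) xx yy xy; ring.
Qed.

(** Up to bounded terms, $-\langle c(t), c'(t)\rangle$ is
$-e^{2t}\langle\xi,\xi'\rangle/4$, so bounded distance forces
$\langle\xi,\xi'\rangle = 0$, and orthogonal null vectors are proportional. *)
Lemma asymptotic_null_rays xi eta xi' eta' c c' :
  null_frame xi eta -> null_frame xi' eta' ->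
  (forall t, 0 <= t -> c t = null_ray xi eta t) ->
  (forall t, 0 <= t -> c' t = null_ray xi' eta' t) ->
  asymptotic c c' -> exists2 k : R, 0 < k & xi' = k *: xi.
Proof.
move=> h h' hc hc' [C hC].
have [xx ee xe x0 e0] := h; have [xx' ee' xe' x0' e0'] := h'.
have hp := null_ray_hyperbolic 0 h.
suff xx'0 : lorentz xi xi' = 0.
  exists (- lorentz (null_ray xi eta 0) xi').
    by rewrite oppr_gt0; exact: null_lorentz_lt0 h' hp.
  apply: null_proportional => //.
  by rewrite /null_ray oppr0 expR0 !lorentzE (lorentzC eta) xx xe; lra.
have u0 := null_lorentz_le0 xx xx' x0 x0'.
apply/eqP; rewrite eq_le u0 leNgt; apply/negP => ult.
have v0 := null_lorentz_le0 xx ee' x0 e0'.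
have w0 := null_lorentz_le0 ee xx' e0 x0'.
have z0 := null_lorentz_le0 ee ee' e0 e0'.
have key t : 0 <= t -> expR t ^+ 2 * (- lorentz xi xi') <= 4 * expR C.
  move=> t0.
  have := hyperbolic_lorentz_leN1 (null_ray_hyperbolic t h) (null_ray_hyperbolic t h').
  rewrite -lerN2 opprK => /le_expR_arcosh.
  have := hC t t0; rewrite hc// hc'// /hdist -ler_expR => le1 le2.
  have := le_trans le2 le1.
  rewrite /null_ray !lorentzE.
  have e0t := expR_gt0 t; have e0t' := expR_gt0 (- t).
  have := mulr_ge0_le0 (ltW (mulr_gt0 e0t e0t')) v0.
  have := mulr_ge0_le0 (ltW (mulr_gt0 e0t e0t')) w0.
  have := mulr_ge0_le0 (ltW (mulr_gt0 e0t' e0t')) z0.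
  lra.
have le t : 0 <= t -> (1 + t) * (- lorentz xi xi') <= 4 * expR C.
  move=> t0; apply: le_trans (key t t0); apply: ler_wpM2r; first by lra.
  by have := expR_ge1Dx t; nra.
have C0 := expR_gt0 C.
(* At [t = q] the linear lower bound exceeds the upper bound. *)
pose q := 4 * expR C / - lorentz xi xi'.
have q0 : 0 <= q by rewrite divr_ge0 ?mulr_ge0 ?ltW// oppr_gt0.
have qE : q * - lorentz xi xi' = 4 * expR C by rewrite divfK// oppr_eq0 lt_eqF.
by have := le q q0; rewrite mulrDl qE; lra.
Qed.

(** The ray chosen in the class may have a null vector $\xi'$ different from
$\xi$, but a positive multiple of it, and the factor cancels in the difference
of logarithms. *)
Lemma busemann_ray_class o x xi eta :
  null_frame xi eta -> hyperbolic_space o -> hyperbolic_space x ->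
  busemann (ray_class (null_ray xi eta)) o x =
  ln (- lorentz x xi) - ln (- lorentz o xi).
Proof.
move=> h ho hx; set a := ray_class _.
have ha : visual_boundary a.
  by exists (null_ray xi eta) => //; exact: null_ray_geodesic.
have [xi' [eta' [h' r']]] := geodesic_ray_null (visual_boundary_ray ha).
have [_ as'] := ray_to_mem ha.
have [k k0 kE] := asymptotic_null_rays h h' (fun _ _ => erefl) r' as'.
have pos y : hyperbolic_space y -> - lorentz y xi \is Num.pos.
  by move=> hy; rewrite posrE oppr_gt0; exact: null_lorentz_lt0 h hy.
rewrite (busemann_null_ray h' ho hx r') kE !lorentzZr -!mulrN.
by rewrite !lnM ?pos// ?posrE//; ring.
Qed.

End Boundary.

(** * Directional derivatives and symmetry of second derivatives *)

Section Calculus.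
Variables (R : realType) (V : normedModType R).
Implicit Types (x v w : V).

Lemma is_derive_entry p q (f : V -> 'M[R]_(p, q)) x v i j : derivable f x v ->
  is_derive x v (fun y => f y i j) ('D_v f x i j).
Proof.
move=> df; rewrite derive_mx// mxE; apply: derivableP.
by move/derivable_mxP : df; apply.
Qed.

Lemma is_derive_lorentz n (f g : V -> 'rV[R]_n.+1) x v :
  derivable f x v -> derivable g x v ->
  is_derive x v (fun y => lorentz (f y) (g y))
    (lorentz ('D_v f x) (g x) + lorentz (f x) ('D_v g x)).
Proof.
move=> df dg.
have M i := is_deriveM (is_derive_entry 0 i df) (is_derive_entry 0 i dg).
have := is_deriveD (is_deriveN (M ord0)) (is_derive_sum (fun i => M (lift ord0 i))).
rewrite fct_sumE => H.
apply: is_derive_eq H _.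
rewrite [RHS]addrACA -opprD -big_split/=; congr (- _ + _).
  by rewrite addrC; congr (_ + _); exact: mulrC.
by apply: eq_bigr => i _; rewrite addrC; congr (_ + _); exact: mulrC.
Qed.

Lemma is_derive_lorentzl n (f : V -> 'rV[R]_n.+1) (z : 'rV[R]_n.+1) x v :
  derivable f x v ->
  is_derive x v (fun y => lorentz (f y) z) (lorentz ('D_v f x) z).
Proof.
move=> df; have := is_derive_lorentz df (derivable_cst z x v).
by rewrite derive_cst (lorentzC (f x)) lorentz0l addr0.
Qed.

(** Restricting to lines turns directional derivatives into derivatives of
functions of one variable, to which the mean value theorem applies. *)
Lemma is_derive_line (f : V -> R) x v (t d : R) :
  is_derive (t *: v + x) v f d ->
  is_derive t 1 (fun s : R => f (s *: v + x)) d.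
Proof.
move=> [df fd].
have e : (fun h : R =>
      h^-1 *: (f ((h *: 1 + t) *: v + x) - f (t *: v + x))) =
   (fun h : R => h^-1 *: (f (h *: v + (t *: v + x)) - f (t *: v + x))).
  apply/funext => h; congr (_ *: (f _ - _)).
  by rewrite [h *: 1]mulr1 scalerDl addrA.
by split; rewrite /derivable /derive /= e.
Qed.

Definition second_difference (f : V -> R) v w x (s : R) :=
  f (s *: v + (s *: w + x)) - f (s *: v + x) - (f (s *: w + x) - f x).

Lemma second_differenceC (f : V -> R) v w x s :
  second_difference f v w x s = second_difference f w v x s.
Proof.
by rewrite /second_difference [s *: v + (_ + _)]addrCA; ring.
Qed.

(** The mean value theorem is applied twice: in the direction [v] to the
difference of [f] along two parallel segments, then in the direction [w] to
[fv]. *)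
Lemma second_difference_mvt (f fv fvw : V -> R) v w x (s : R) : 0 < s ->
  (forall a b, 0 <= a <= s -> 0 <= b <= s ->
    is_derive (a *: v + (b *: w + x)) v f (fv (a *: v + (b *: w + x))) /\
    is_derive (a *: v + (b *: w + x)) w fv (fvw (a *: v + (b *: w + x)))) ->
  exists a b, [/\ 0 <= a <= s, 0 <= b <= s &
    second_difference f v w x s = s ^+ 2 * fvw (a *: v + (b *: w + x))].
Proof.
move=> s0 H.
have ss : 0 <= s <= s by rewrite lexx (ltW s0).
have s00 : 0 <= (0 : R) <= s by rewrite lexx (ltW s0).
pose g (t : R) := f (t *: v + (s *: w + x)) - f (t *: v + x).
pose g' (t : R) := fv (t *: v + (s *: w + x)) - fv (t *: v + x).
have gd (t : R) : 0 <= t <= s -> is_derive t 1 g (g' t).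
  move=> ts; apply: is_deriveB; apply: is_derive_line.
    by have [] := H _ _ ts ss.
  by have := H _ _ ts s00; rewrite scale0r add0r => -[].
have [t|/=|a ain] := @MVT_segment R g g' 0 s (ltW s0).
- by rewrite in_itv/= => /andP[t0 t1]; apply: gd; rewrite !ltW.
- apply: derivable_within_continuous => t; rewrite in_itv/= => ts.
  by have [] := gd _ ts.
have {}ain : 0 <= a <= s by move: ain; rewrite in_itv.
rewrite subr0 => gE.
pose k (t : R) := fv (t *: w + (a *: v + x)).
pose k' (t : R) := fvw (t *: w + (a *: v + x)).
have kd (t : R) : 0 <= t <= s -> is_derive t 1 k (k' t).
  move=> ts; apply: is_derive_line.
  by have [_] := H _ _ ain ts; rewrite addrCA.
have [t|/=|b bin] := @MVT_segment R k k' 0 s (ltW s0).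
- by rewrite in_itv/= => /andP[t0 t1]; apply: kd; rewrite !ltW.
- apply: derivable_within_continuous => t; rewrite in_itv/= => ts.
  by have [] := kd _ ts.
have {}bin : 0 <= b <= s by move: bin; rewrite in_itv.
rewrite subr0 /k /k' scale0r add0r => kE.
exists a, b; split => //.
transitivity (g s - g 0).
  by rewrite /second_difference /g scale0r !add0r.
rewrite gE /g' [a *: v + (s *: w + x)]addrCA kE [a *: v + (_ + _)]addrCA; ring.
Qed.

Lemma near_parallelogram (P : set V) v w x : nbhs x P ->
  exists2 s : R, 0 < s & forall a b, 0 <= a <= s -> 0 <= b <= s ->
    P (a *: v + (b *: w + x)).
Proof.
move=> /nbhs_ballP[e /= e0 eP].
have d0 : 0 < `|v| + `|w| + 1 by rewrite ltr_wpDl// addr_ge0.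
exists (e / (2 * (`|v| + `|w| + 1))); first by rewrite divr_gt0// mulr_gt0.
move=> a b /andP[a0 a1] /andP[b0 b1]; apply: eP.
rewrite -ball_normE/= addrA opprD addrCA subrr addr0 normrN.
apply: le_lt_trans (ler_normD _ _) _; rewrite !normrZ !ger0_norm//.
have sE : e / (2 * (`|v| + `|w| + 1)) * (`|v| + `|w| + 1) = e / 2.
  by field; rewrite gt_eqF.
set s := e / (2 * _) in a1 b1 sE *.
have := ler_wpM2r (normr_ge0 v) a1; have := ler_wpM2r (normr_ge0 w) b1.
have : 0 <= s by exact: le_trans a0 a1.
by lra.
Qed.

(** The second difference is symmetric in [v] and [w]; after division by
$s^2$ it is a value of [fvw] and also a value of [fwv], at points that tend to
[x]. Separate names for the derivatives allow applying this to the entries of a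
vector-valued function. *)
Lemma derive_symmetric (f fv fw fvw fwv : V -> R) v w x :
  (\forall y \near x, is_derive y v f (fv y) /\ is_derive y w fv (fvw y)) ->
  (\forall y \near x, is_derive y w f (fw y) /\ is_derive y v fw (fwv y)) ->
  {for x, continuous fvw} -> {for x, continuous fwv} -> fvw x = fwv x.
Proof.
move=> dvw dwv cvw cwv; apply/eqP; rewrite -subr_eq0 -normr_le0.
apply/ler_addgt0Pl => e e0; rewrite addr0.
have e2 : 0 < e / 2 by rewrite divr_gt0.
move/cvgrPdist_lt : cvw => /(_ _ e2) cvw.
move/cvgrPdist_lt : cwv => /(_ _ e2) cwv.
have [s s0 sP] :=
  near_parallelogram v w (filterI (filterI dvw dwv) (filterI cvw cwv)).
have [a b ain bin|a [b [ain bin E1]]] :=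
    @second_difference_mvt f fv fvw v w x s s0.
  by have [[]] := sP _ _ ain bin.
have [a' b' ain' bin'|a' [b' [ain' bin' E2]]] :=
    @second_difference_mvt f fw fwv w v x s s0.
  by have := sP _ _ bin' ain'; rewrite addrCA => -[[]].
rewrite second_differenceC E2 in E1.
have sn0 : s ^+ 2 != 0 by rewrite sqrf_eq0 gt_eqF.
move/(mulfI sn0) : E1 => E1.
have [_ [h1 _]] := sP _ _ ain bin; have [_ [_ h2]] := sP _ _ bin' ain'.
move: h1 h2 => /=; rewrite -E1 [b' *: v + (_ + _)]addrCA.
move: (fvw x) (fwv x) (fwv _) => A B C h1 h2.
rewrite (_ : A - B = (A - C) - (B - C)); last by ring.
apply: le_trans (ler_normB _ _) _; rewrite [e in leRHS]splitr.
exact: lerD (ltW h1) (ltW h2).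
Qed.

End Calculus.

Section MoreCalculus.
Variables (R : realType).

Lemma is_derive_along (V W : normedModType R) (f : V -> W) x v d :
  is_derive x v f d <-> is_derive (0 : R) 1 (fun h : R => f (h *: v + x)) d.
Proof.
have e : (fun h : R => h^-1 *:
      (f ((h *: (1 : R) + (0 : R)) *: v + x) - f ((0 : R) *: v + x))) =
   (fun h : R => h^-1 *: (f (h *: v + x) - f x)).
  by apply/funext => h; rewrite addr0 scale0r add0r [h *: 1]mulr1.
by split=> -[d1 d2]; split; move: d1 d2; rewrite /derivable /derive /= e.
Qed.

Lemma is_derive_ln_comp (V : normedModType R) (h : V -> R) x v d :
  0 < h x -> is_derive x v h d -> is_derive x v (fun y => ln (h y)) (d / h x).
Proof.
move=> h0 /is_derive_along dh; apply/is_derive_along; rewrite mulrC.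
have h0' : 0 < h (0 *: v + x) by rewrite scale0r add0r.
have := @is_derive1_comp _ (@ln R) (fun s : R => h (s *: v + x)) 0 _ _
  (is_derive1_ln h0') dh.
by rewrite scale0r add0r.
Qed.

Lemma is_derive_div (V : normedModType R) (g h : V -> R) x v dg dh :
  h x != 0 -> is_derive x v g dg -> is_derive x v h dh ->
  is_derive x v (fun y => g y / h y) (dg / h x - g x * dh / h x ^+ 2).
Proof.
move=> h0 Dg [exh Dh].
have Dhv : is_derive x v (fun y => (h y)^-1) (- (h x) ^- 2 *: dh).
  by apply: DeriveDef; [exact: derivableV | rewrite deriveV// Dh].
apply: is_derive_eq (is_deriveM Dg Dhv) _.
by rewrite /GRing.scale/=; field.
Qed.

Lemma derive_coordinates m (W : normedModType R) (f : 'rV[R]_m -> W) x v :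
  differentiable f x -> 'D_v f x = \sum_i v 0 i *: partial i f x.
Proof.
move=> df; rewrite deriveE// {1}(row_sum_delta v) linear_sum/=.
by apply: eq_bigr => i _; rewrite linearZ/= /partial deriveE.
Qed.

End MoreCalculus.

(** * Linear algebra of the second fundamental form *)

Section LorentzSums.
Variables (R : realType) (m n : nat).
Implicit Types (p z xi : 'rV[R]_n.+1) (e : 'I_m -> 'rV[R]_n.+1) (v : 'rV[R]_m).

Lemma lorentz_sumZl v e z :
  lorentz (\sum_i v 0 i *: e i) z = \sum_i v 0 i * lorentz (e i) z.
Proof. by rewrite lorentz_suml; apply: eq_bigr => i _; rewrite lorentzZl. Qed.

(** The subtracted double sum is the orthogonal projection of [z] to the span of
the [e k], which exists as soon as their Gram matrix is invertible, even though
the form is indefinite. *)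
Lemma gram_projection_orthogonal (g : 'M[R]_m) e z l : g \in unitmx ->
  (forall i j, g i j = lorentz (e i) (e j)) ->
  lorentz (z - \sum_k \sum_l (invmx g k l * lorentz z (e l)) *: e k) (e l) = 0.
Proof.
move=> gU gE; rewrite lorentzBl lorentz_suml.
under eq_bigr do rewrite lorentz_suml.
rewrite exchange_big/= (eq_bigr (fun j => lorentz z (e j) * (l == j)%:R)).
  rewrite (bigD1 l)//= eqxx mulr1 big1 ?addr0 ?subrr// => j jl.
  by rewrite eq_sym (negbTE jl) mulr0.
move=> j _; have /matrixP/(_ l j) := mulmxV gU; rewrite !mxE => <-.
rewrite mulr_sumr; apply: eq_bigr => k _.
by rewrite lorentzZl gE (lorentzC (e l)); ring.
Qed.

(** For [p] the point and [e] the coordinate vectors: the component along [p]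
that makes an ambient vector tangent to the hyperboloid does not change its
projection to the immersed submanifold. *)
Lemma sum_orthogonal_shift (G : 'M[R]_m) e p z a :
  (forall l, lorentz (e l) p = 0) ->
  \sum_k \sum_l (G k l * lorentz (z + a *: p) (e l)) *: e k =
  \sum_k (\sum_l G k l * lorentz z (e l)) *: e k.
Proof.
move=> ep; apply: eq_bigr => k _; rewrite scaler_suml; apply: eq_bigr => l _.
by rewrite lorentzDl lorentzZl (lorentzC p) ep mulr0 addr0.
Qed.

(** To be read with [p] $= f$, [ei], [ej] $= \partial_i f, \partial_j f$, [h]
$= \partial_i\partial_j f$ and [g] $= g_{ij}$: on the left the covariant second
derivative of $\ln(-\langle f,\xi\rangle)$, on the right its expression by the
normal component of [h]. *)
Lemma log_hessian_entry (Gam : 'I_m -> R) e (h ei ej p xi : 'rV[R]_n.+1) (g : R) :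
  lorentz p xi != 0 ->
  lorentz h xi / lorentz p xi
  - lorentz ej xi * lorentz ei xi / lorentz p xi ^+ 2
  - \sum_k Gam k * (lorentz (e k) xi / lorentz p xi) =
  lorentz (h - g *: p - \sum_k Gam k *: e k) xi / lorentz p xi + g
  - lorentz ei xi / lorentz p xi * (lorentz ej xi / lorentz p xi).
Proof.
move=> c0; rewrite !lorentzBl lorentzZl lorentz_suml.
have -> : \sum_k Gam k * (lorentz (e k) xi / lorentz p xi) =
    (\sum_k lorentz (Gam k *: e k) xi) / lorentz p xi.
  by rewrite mulr_suml; apply: eq_bigr => k _; rewrite lorentzZl mulrA.
by field.
Qed.

Lemma quadratic_sum (N : 'I_m -> 'I_m -> 'rV[R]_n.+1) e v xi (c : R) :
  \sum_i \sum_j v 0 i * v 0 j *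
    (lorentz (N i j) xi / c + lorentz (e i) (e j)
     - lorentz (e i) xi / c * (lorentz (e j) xi / c)) =
  lorentz (\sum_i \sum_j (v 0 i * v 0 j) *: N i j) xi / c
  + lorentz (\sum_i v 0 i *: e i) (\sum_i v 0 i *: e i)
  - (lorentz (\sum_i v 0 i *: e i) xi / c) ^+ 2.
Proof.
rewrite expr2 lorentz_suml !lorentz_sumZl !mulr_suml -big_split -sumrB/=.
apply: eq_bigr => i _.
rewrite lorentz_suml [lorentz (e i) (\sum_(j < m) _)]lorentzC lorentz_sumZl.
rewrite mulr_suml !mulr_sumr -big_split -sumrB/=.
by apply: eq_bigr => j _; rewrite lorentzZl (lorentzC (e j) (e i)); ring.
Qed.

End LorentzSums.

(** * The Hessian of the logarithm of a linear form *)

Section LocalGeometry.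
Variables (R : realType) (m n : nat) (U : set 'rV[R]_m).
Variable f : 'rV[R]_m -> 'rV[R]_n.+1.
Hypotheses (openU : open U) (smooth_f : smooth_on U f).
Hypothesis hyp_f : forall y, hyperbolic_space (f y).
Implicit Types (x y v w : 'rV[R]_m) (xi : 'rV[R]_n.+1).

Lemma smooth_differentiable x : U x -> differentiable f x.
Proof. by have [h _] := smooth_f 1; exact: h. Qed.

Lemma smooth_derivable x v : U x -> derivable f x v.
Proof. by move=> /smooth_differentiable df; exact: diff_derivable. Qed.

Lemma smooth_derivable2 x v w : U x -> derivable (fun y => 'D_v f y) x w.
Proof.
by have [_ /(_ v) [h _]] := smooth_f 2; move=> /h df; exact: diff_derivable.
Qed.

Lemma smooth_continuous2 x v w : U x ->
  {for x, continuous (fun y => 'D_w (fun z => 'D_v f z) y)}.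
Proof.
have [_ /(_ v) h] := smooth_f 2; have [_ /(_ w) hw] := h; exact: hw.
Qed.

Lemma near_open x : U x -> \forall y \near x, U y.
Proof. by move=> Ux; exact: open_nbhs_nbhs. Qed.

Lemma smooth_derive_symmetric x v w : U x ->
  'D_w (fun z => 'D_v f z) x = 'D_v (fun z => 'D_w f z) x.
Proof.
move=> Ux; apply/rowP => k.
have d1 v' w' : \forall y \near x,
    is_derive y v' (fun z => f z 0 k) ('D_v' f y 0 k) /\
    is_derive y w' (fun z => 'D_v' f z 0 k) ('D_w' (fun z => 'D_v' f z) y 0 k).
  near=> y; have Uy : U y by near: y; exact: near_open.
  split; apply: is_derive_entry; first exact: smooth_derivable.
  exact: smooth_derivable2.
have c1 v' w' : {for x, continuous (fun y => 'D_w' (fun z => 'D_v' f z) y 0 k)}.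
  apply: (continuous_comp (f := fun y => 'D_w' (fun z => 'D_v' f z) y)
    (g := fun z : 'rV[R]_n.+1 => z 0 k)); last exact: coord_continuous.
  exact: smooth_continuous2.
exact: derive_symmetric (d1 v w) (d1 w v) (c1 v w) (c1 w v).
Unshelve. all: by end_near. Qed.

Lemma lorentz_derive_self x v : U x -> lorentz ('D_v f x) (f x) = 0.
Proof.
move=> Ux; have df : derivable f x v by exact: smooth_derivable.
have [_] := is_derive_lorentz df df.
rewrite (_ : (fun y => lorentz (f y) (f y)) = cst (-1)); last first.
  by apply/funext => y; have [] := hyp_f y.
rewrite derive_cst (lorentzC (f x)) => h; lra.
Qed.

(** Differentiate $\langle \partial_v f, f\rangle = 0$ along [w]. *)
Lemma lorentz_derive2_self x v w : U x ->
  lorentz ('D_w (fun y => 'D_v f y) x) (f x) =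
  - lorentz ('D_v f x) ('D_w f x).
Proof.
move=> Ux.
have [_] := is_derive_lorentz (smooth_derivable2 (v := v) (w := w) Ux)
  (smooth_derivable (v := w) Ux).
rewrite (@near_eq_derive _ _ _ _ (cst 0)); last first.
  near=> y; apply: lorentz_derive_self; near: y; exact: near_open.
by rewrite derive_cst => h; lra.
Unshelve. all: by end_near. Qed.

(** In the Koszul formula each derivative of a metric coefficient splits into
two terms $P_{abc} = \langle\partial_a\partial_b f,\partial_c f\rangle$; as
$P$ is symmetric in its first two indices, all of them cancel but
$2 P_{ijl}$. *)
Lemma christoffel_induced x k i j : U x ->
  christoffel (induced_metric f) k i j x =
  \sum_l invmx (induced_metric f x) k l *
    lorentz (partial i (partial j f) x) (partial l f x).
Proof.
move=> Ux.
pose P a b c := lorentz (partial a (partial b f) x) (partial c f x).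
have Psym a b c : P a b c = P b a c.
  have sym : partial a (partial b f) x = partial b (partial a f) x.
    exact: smooth_derive_symmetric.
  by rewrite /P sym.
have dg a b c : partial a (fun y => induced_metric f y b c) x = P a b c + P a c b.
  rewrite (_ : (fun y => _) = (fun y => lorentz (partial b f y) (partial c f y))).
    have [_] := is_derive_lorentz (x := x) (v := delta_mx 0 a)
      (smooth_derivable2 (v := delta_mx 0 b) Ux)
      (smooth_derivable2 (v := delta_mx 0 c) Ux).
    by rewrite [X in _ = _ + X -> _]lorentzC.
  by apply/funext => y; rewrite mxE.
rewrite /christoffel mulr_sumr; apply: eq_bigr => l _; rewrite !dg -/(P i j l).
move: P Psym {dg} => P Psym.
by rewrite (Psym l i) (Psym l j) (Psym j i); field.
Qed.

Definition second_normal x i j :=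
  normal_part f x (tangent_proj (f x) (partial i (partial j f) x)).

(** The two corrections to $\partial_i\partial_j f$ have different origins: the
multiple of [f x] comes from projecting to the tangent space of the hyperboloid,
the combination of the $\partial_k f$ from the Levi-Civita connection of the
induced metric. *)
Lemma second_normalE x i j : U x -> second_normal x i j =
  partial i (partial j f) x
  - lorentz (partial i f x) (partial j f x) *: f x
  - \sum_k christoffel (induced_metric f) k i j x *: partial k f x.
Proof.
move=> Ux; rewrite /second_normal /normal_part /tangent_proj.
rewrite sum_orthogonal_shift; last by move=> l; exact: lorentz_derive_self.
rewrite lorentz_derive2_self// scaleNr [lorentz (partial j f x) _]lorentzC.
by congr (_ - _); apply: eq_bigr => k _; rewrite christoffel_induced.
Qed.

Lemma derive_log y w xi (C : R) : U y -> lorentz (f y) xi < 0 ->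
  'D_w (fun z => ln (- lorentz (f z) xi) - C) y =
  lorentz ('D_w f y) xi / lorentz (f y) xi.
Proof.
move=> Uy neg; have pos : 0 < - lorentz (f y) xi by rewrite oppr_gt0.
have H : is_derive y w (fun z => - lorentz (f z) xi) (- lorentz ('D_w f y) xi).
  by apply: is_deriveN; apply: is_derive_lorentzl; exact: smooth_derivable.
have [_] := is_deriveB
  (is_derive_ln_comp (h := fun z => - lorentz (f z) xi) pos H)
  (is_derive_cst C y w).
by rewrite subr0 invrN mulrNN.
Qed.

Lemma hessian_log x v xi (C : R) : U x ->
  (forall y, lorentz (f y) xi < 0) ->
  hessian (induced_metric f) (fun y => ln (- lorentz (f y) xi) - C) x v v =
  lorentz (second_fundamental_form f x v v) xi / lorentz (f x) xi
  + lorentz ('D_v f x) ('D_v f x)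
  - (lorentz ('D_v f x) xi / lorentz (f x) xi) ^+ 2.
Proof.
move=> Ux hneg; set F := fun y => _.
have Fd y w : U y -> 'D_w F y = lorentz ('D_w f y) xi / lorentz (f y) xi.
  by move=> Uy; exact: derive_log.
have Fdd i j : partial i (partial j F) x =
    lorentz (partial i (partial j f) x) xi / lorentz (f x) xi
    - lorentz (partial j f x) xi * lorentz (partial i f x) xi /
      lorentz (f x) xi ^+ 2.
  have near_F : \near x, partial j F x =
      lorentz (partial j f x) xi / lorentz (f x) xi.
    by near=> y; apply: Fd; near: y; exact: near_open.
  rewrite [LHS](near_eq_derive _ near_F).
  have dA := is_derive_lorentzl xi
    (smooth_derivable2 (v := delta_mx 0 j) (w := delta_mx 0 i) Ux).
  have dB := is_derive_lorentzl xi (smooth_derivable (v := delta_mx 0 i) Ux).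
  have [_ dF] := is_derive_div (h := fun y => lorentz (f y) xi)
    (ltr0_neq0 (hneg x)) dA dB.
  exact: dF.
rewrite (derive_coordinates v (smooth_differentiable Ux)).
rewrite -[RHS](quadratic_sum (second_normal x) (fun i => partial i f x)).
apply: eq_bigr => i _; apply: eq_bigr => j _; congr (_ * _).
rewrite second_normalE// -(log_hessian_entry _ _ _ _ _ _ (ltr0_neq0 (hneg x))) Fdd.
by congr (_ - _); apply: eq_bigr => k _; congr (_ * _); exact: Fd.
Unshelve. all: by end_near. Qed.

End LocalGeometry.

(** * Principal curvatures and Hessians of Busemann functions *)

Section UnitDirections.
Variables (R : realType) (n : nat).
Implicit Types (p w e xi : 'rV[R]_n.+1).

Lemma lorentz_norm_sqr p w : hyperbolic_space p -> lorentz w p = 0 ->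
  lorentz_norm w ^+ 2 = lorentz w w.
Proof.
by move=> hp wp; rewrite sqr_sqrtr//; exact: hyperbolic_orthogonal_ge0 hp wp.
Qed.

(** Cauchy-Schwarz on the tangent space at [p]: the vector [w] minus its
component along [e] has nonnegative square. *)
Lemma lorentz_le_norm p w e : hyperbolic_space p -> lorentz w p = 0 ->
  lorentz e p = 0 -> lorentz e e = 1 -> lorentz w e <= lorentz_norm w.
Proof.
move=> hp wp ep ee; apply: le_trans (ler_norm _) _.
rewrite -ler_sqr ?nnegrE ?normr_ge0 ?sqrtr_ge0// (lorentz_norm_sqr hp wp).
rewrite real_normK ?num_real//.
have := @hyperbolic_orthogonal_ge0 _ _ p (w - lorentz w e *: e) hp.
rewrite !lorentzE wp ep ee (lorentzC e w) => /(_ ltac:(ring)); lra.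
Qed.

(** Rescaling a null vector so that it pairs to [-1] with [p] turns it into
[p] plus a unit tangent vector, the initial direction of the ray from [p]
pointing to it. *)
Lemma null_direction p xi : hyperbolic_space p -> lorentz xi xi = 0 ->
  lorentz p xi < 0 ->
  let e := - (lorentz p xi)^-1 *: xi - p in
  lorentz e p = 0 /\ lorentz e e = 1.
Proof.
move=> [pp _] xx neg e; rewrite /e !lorentzE (lorentzC xi p) xx pp.
by split; field; rewrite lt_eqF.
Qed.

End UnitDirections.

Section SecondFundamentalForm.
Variables (R : realType) (m n : nat) (U : set 'rV[R]_m).
Variable f : 'rV[R]_m -> 'rV[R]_n.+1.
Hypotheses (openU : open U) (smooth_f : smooth_on U f).
Hypothesis hyp_f : forall y, hyperbolic_space (f y).
Variables (x : 'rV[R]_m) (Ux : U x).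
Hypothesis imm : forall v : 'rV[R]_m, v != 0 -> 'D_v f x != 0.

Let dfE v : 'D_v f x = \sum_i v 0 i *: partial i f x.
Proof. exact: derive_coordinates (smooth_differentiable smooth_f Ux). Qed.

Let df_orth v : lorentz ('D_v f x) (f x) = 0.
Proof. exact: (lorentz_derive_self smooth_f hyp_f). Qed.

Lemma derive_sqr_gt0 (v : 'rV[R]_m) : v != 0 -> 0 < lorentz ('D_v f x) ('D_v f x).
Proof.
move=> v0; rewrite lt_neqAle (hyperbolic_orthogonal_ge0 (hyp_f x)) ?df_orth// andbT.
rewrite eq_sym; apply: contra (imm v0) => /eqP h.
by apply/eqP; exact: (hyperbolic_orthogonal_eq0 (hyp_f x)).
Qed.

(** A vector [v] in the kernel of the metric gives a tangent vector orthogonal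
to all $\partial_l f$, hence to itself; an immersion allows only $v = 0$. *)
Lemma induced_metric_unit : induced_metric f x \in unitmx.
Proof.
rewrite -row_free_unit; apply: inj_row_free => v vg.
apply/eqP/negPn/negP => /derive_sqr_gt0.
suff -> : lorentz ('D_v f x) ('D_v f x) = 0 by rewrite ltxx.
have vl l : lorentz ('D_v f x) (partial l f x) = 0.
  move/rowP : vg => /(_ l); rewrite !mxE => <-.
  by rewrite dfE lorentz_sumZl; apply: eq_bigr => i _; rewrite mxE.
rewrite {2}dfE lorentzC lorentz_sumZl big1// => l _.
by rewrite lorentzC vl mulr0.
Qed.

Lemma normal_part_orthogonal z l :
  lorentz (normal_part f x z) (partial l f x) = 0.
Proof.
apply: (@gram_projection_orthogonal R m n (induced_metric f x) (fun k => partial k f x)).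
  exact: induced_metric_unit.
by move=> i j; rewrite mxE.
Qed.

Lemma second_fundamental_form_orthogonal v w :
  lorentz (second_fundamental_form f x v v) (f x) = 0 /\
  lorentz (second_fundamental_form f x v v) ('D_w f x) = 0.
Proof.
split; rewrite lorentz_suml big1// => i _; rewrite lorentz_suml big1// => j _;
    rewrite lorentzZl -/(second_normal f x i j).
  rewrite (second_normalE openU smooth_f hyp_f)// !lorentzBl lorentzZl.
  rewrite (lorentz_derive2_self openU smooth_f hyp_f)//.
  rewrite [X in _ - X]lorentz_suml big1 => [|k _].
    by have [-> _] := hyp_f x; rewrite [lorentz (partial j f x) _]lorentzC; ring.
  by rewrite lorentzZl [X in _ * X]df_orth mulr0.
rewrite lorentzC dfE lorentz_sumZl big1 ?mulr0// => l _.
by rewrite lorentzC normal_part_orthogonal mulr0.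
Qed.

Variables (o : 'rV[R]_n.+1) (ho : hyperbolic_space o).

(** The equivalence for a single tangent vector. The boundary point that detects
a large second fundamental form is the endpoint of the ray leaving [f x] in its
direction. *)
Lemma busemann_hessian_gt0_iff (v : 'rV[R]_m) : v != 0 ->
  (forall a, visual_boundary a -> 'D_v (busemann a o \o f) x = 0 ->
     0 < hessian (induced_metric f) (busemann a o \o f) x v v) <->
  lorentz_norm (second_fundamental_form f x v v) < lorentz_norm ('D_v f x) ^+ 2.
Proof.
move=> v0; have [IIf IIV] := second_fundamental_form_orthogonal v v.
have fH := hyp_f x; have [ff _] := fH; have Vf := df_orth v.
have hess := hessian_log openU smooth_f hyp_f v _ Ux.
have dlog xi C (neg : lorentz (f x) xi < 0) :=
  derive_log smooth_f v C Ux neg.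
have V0 := derive_sqr_gt0 v0.
rewrite (lorentz_norm_sqr fH Vf).
move: (second_fundamental_form f x v v) IIf IIV hess => II IIf IIV hess.
have IIsq := lorentz_norm_sqr fH IIf.
split=> [ng|lt a ha].
  have [II0|IIn0] := eqVneq II 0.
    by rewrite II0 /lorentz_norm lorentz0l sqrtr0.
  set s := lorentz_norm II in IIsq *.
  have s0 : 0 < s.
    rewrite lt_neqAle sqrtr_ge0 andbT eq_sym; apply: contra IIn0 => /eqP s0.
    apply/eqP; apply: (hyperbolic_orthogonal_eq0 fH) => //.
    by rewrite -IIsq s0 expr0n.
  have sn0 : s != 0 by rewrite gt_eqF.
  pose e := s^-1 *: II.
  have fe : lorentz e (f x) = 0 by rewrite /e lorentzZl IIf mulr0.
  have ee : lorentz e e = 1.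
    by rewrite /e lorentzZl lorentzZr -IIsq; field.
  have fr := null_frame_of_unit fH fe ee.
  set xi := f x + e in fr; have neg y : lorentz (f y) xi < 0.
    exact: null_lorentz_lt0 fr (hyp_f y).
  have fxi : lorentz (f x) xi = -1 by rewrite /xi lorentzDr ff lorentzC fe addr0.
  have Vxi : lorentz ('D_v f x) xi = 0.
    by rewrite /xi lorentzDr Vf add0r /e lorentzZr lorentzC IIV mulr0.
  have IIxi : lorentz II xi = s.
    by rewrite /xi lorentzDr IIf add0r /e lorentzZr -IIsq; field.
  have := ng (ray_class (null_ray xi (f x - e))).
  have -> : busemann (ray_class (null_ray xi (f x - e))) o \o f =
      (fun y => ln (- lorentz (f y) xi) - ln (- lorentz o xi)).
    by apply/funext => y /=; exact: busemann_ray_class.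
  rewrite dlog// hess// Vxi fxi IIxi mul0r.
  move=> /(_ _ erefl) h; suff : visual_boundary (ray_class (null_ray xi (f x - e))).
    by move/h; lra.
  by exists (null_ray xi (f x - e)) => //; exact: null_ray_geodesic.
have [xi [eta [fr ra]]] := geodesic_ray_null (visual_boundary_ray ha).
have neg y : lorentz (f y) xi < 0 by exact: null_lorentz_lt0 fr (hyp_f y).
have -> : busemann a o \o f = (fun y => ln (- lorentz (f y) xi) - ln (- lorentz o xi)).
  by apply/funext => y /=; exact: busemann_null_ray fr ho (hyp_f y) ra.
rewrite dlog// hess// => ->; rewrite expr0n subr0.
have [xx _ _ _ _] := fr.
have [ef ee] := null_direction fH xx (neg x).
have := lorentz_le_norm fH IIf ef ee.
rewrite lorentzBr lorentzZr IIf; lra.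
Qed.

End SecondFundamentalForm.

Theorem proposition5p5 (R : realType) (m n : nat) (hn : (0 < n)%N)
    (M : topologicalType) (A : set (chart R m M)) (o : 'rV[R]_n.+1)
    (u : M -> 'rV[R]_n.+1) :
  smooth_manifold A -> connected [set: M] ->
  hyperbolic_space o ->
  immersion A u ->
  nearly_geodesic A u o <-> principal_curvature_lt1 A u.
Proof.
move=> _ _ ho [uH us ui].
have local c p v (Ac : A c) (cp : chart_dom c p) (v0 : v != 0) :=
  busemann_hessian_gt0_iff (@chart_cod_open R m M c) (us c Ac)
    (fun y => uH (chart_inv c y)) (chart_map_cod cp)
    (fun w => ui c p w Ac cp) ho v0.
split=> [ng c p v Ac cp v0|pc a c p v ha Ac cp v0].
  by apply/(local c p v Ac cp v0) => a ha; exact: ng.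
by move: a ha; apply/(local c p v Ac cp v0); exact: pc.
Qed.
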